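(* Let $X$ and $Y$ be finite nonempty sets and let $F: X \to 2^Y$ be a set-valued mapping. If $F$ satisfies the Hall condition, then $F$ admits a Hall partition.
   Context: A set-valued mapping $F: X \to 2^Y$ assigns to each $x \in X$ a (possibly empty) subset $F(x) \subset Y$. For $W \subset X$ put $F(W) = \bigcup_{x \in W} F(x)$ (empty union is empty); $\sharp$ denotes cardinality. $F$ satisfies the Hall condition if $\sharp F(W) \ge \sharp W$ for every $W \subset X$. For $W \subset X$, $Z \subset Y$, the complement mapping $F_{W,Z}: X \setminus W \to 2^{Y \setminus Z}$ is $F_{W,Z}(x) = F(x) \setminus Z$; write $F_W = F_{W,F(W)}$, so $F_W(x) = F(x)\setminus F(W)$ for $x \in X \setminus W$. These notions apply to any set-valued mapping $G$ defined on a finite set. A subset $W$ of the domain of $G$ is a critical set of $G$ if $W \neq \emptyset$ and $\sharp G(W) = \sharp W$. It is a non-reducible set of $G$ if $W \ne \emptyset$ and no proper subset $W' \subsetneq W$ is a critical set of $G$. A tuple $(W_1, \ldots, W_m)$, $m \ge 1$, is a Hall partition of $F$ if $W_1, \ldots, W_m$ are nonempty pairwise disjoint sets with union $X$, and, writing $G_i = F_{W_1 \cup \cdots \cup W_{i-1}}$ (so $G_1 = F$, and $G_i$ is defined on $X \setminus (W_1\cup\cdots\cup W_{i-1})$): (i) $G_i(x) \neq \emptyset$ for all $x \in W_i$, $i = 1,\ldots,m$; (ii) $W_i$ is a non-reducible set of $G_i$ for $i=1,\ldots,m$; (iii) $W_i$ is a critical set of $G_i$ for $i = 1, \ldots, m-1$.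 *)

(* Defs.v *)
From mathcomp Require Import all_boot.

Set Implicit Arguments.
Unset Strict Implicit.
Unset Printing Implicit Defensive.

(* A set-valued mapping with domain D, a subset of X, is encoded as a total
   function G : X -> {set Y} together with the set D : {set X}; the values of G
   outside D are irrelevant, since every predicate below only looks at subsets
   of D. *)
Section SetValuedMappings.
Variables X Y : finType.
Implicit Types (D W Z : {set X}) (F G : X -> {set Y}).

Definition sv_image G W : {set Y} := \bigcup_(x in W) G x.

Definition hall_condition D G : Prop :=
  forall W, W \subset D -> #|W| <= #|sv_image G W|.

(* The mapping F_{W,Z}; its domain is ~: W when F is defined on all of X. *)
Definition sv_complement F W (Z : {set Y}) : X -> {set Y} :=
  fun x => F x :\: Z.

(* The mapping F_W, with domain ~: W. *)
Definition sv_residual F W : X -> {set Y} :=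
  sv_complement F W (sv_image F W).

Definition critical_set D G W : Prop :=
  [/\ W \subset D, W != set0 & #|sv_image G W| = #|W|].

Definition non_reducible_set D G W : Prop :=
  [/\ W \subset D, W != set0
    & forall W' : {set X}, W' \proper W -> ~ critical_set D G W'].

Section HallPartition.
Variables (F : X -> {set Y}) (m : nat) (W : m.-tuple {set X}).

(* Blocks are indexed from 0 to m.-1. *)
Definition earlier_blocks (i : 'I_m) : {set X} :=
  \bigcup_(j < m | j < i) tnth W j.

Definition hall_partition : Prop :=
  let D i := ~: earlier_blocks i in
  let G i := sv_residual F (earlier_blocks i) in
  [/\ 0 < m,
      [/\ forall i, tnth W i != set0,
          forall i j, i != j -> [disjoint tnth W i & tnth W j]
        & \bigcup_(i < m) tnth W i = [set: X]],
      forall i x, x \in tnth W i -> G i x != set0,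
      forall i, non_reducible_set (D i) (G i) (tnth W i)
    & forall i : 'I_m, i.+1 < m -> critical_set (D i) (G i) (tnth W i)].

End HallPartition.
End SetValuedMappings.

(* Main.v *)
(* Blocks are peeled off greedily.  If #|F(U)| = #|U|, then counting F(U :|: W)
   shows that the residual mapping F_U inherits the Hall condition on the
   complement of U.  If F_U has a critical set, a minimal one is the next block
   and may be absorbed into U; otherwise the whole complement of U is
   non-reducible and serves as the last block. *)
Require Import Defs.
From mathcomp Require Import all_boot.

Set Implicit Arguments.
Unset Strict Implicit.
Unset Printing Implicit Defensive.

Section HallPartitionExistence.
Variables (X Y : finType) (F : X -> {set Y}).
Implicit Types (D U V W : {set X}) (G : X -> {set Y}).

Lemma sv_image0 G : sv_image G set0 = set0.
Proof. exact: big_set0. Qed.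

Lemma sv_image1 G x : sv_image G [set x] = G x.
Proof. exact: big_set1. Qed.

Lemma sv_imageU G U W : sv_image G (U :|: W) = sv_image G U :|: sv_image G W.
Proof. exact: bigcup_setU. Qed.

Lemma sv_image_residual U W :
  sv_image (sv_residual F U) W = sv_image F W :\: sv_image F U.
Proof.
by rewrite setDE big_distrl /=; apply: eq_bigr => x _; exact: setDE.
Qed.

(** The residual image of [W] is exactly the part of F(W) outside F(U), so it and F(U) split F(U :|:
    W) into two disjoint pieces. *)
Lemma card_sv_imageU U W :
  #|sv_image F (U :|: W)| = #|sv_image F U| + #|sv_image (sv_residual F U) W|.
Proof.
by rewrite sv_imageU sv_image_residual cardsU cardsD addnBA 1?setIC //
           subset_leq_card // subsetIr.
Qed.

Lemma card_setU_subC U W : W \subset ~: U -> #|U :|: W| = #|U| + #|W|.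
Proof.
by rewrite -disjoints_subset disjoint_sym => dUW; apply/eqP; rewrite leq_card_setU.
Qed.

Lemma hall_condition_residual U :
  hall_condition [set: X] F -> #|sv_image F U| = #|U| ->
  hall_condition (~: U) (sv_residual F U).
Proof.
move=> hallF critU W sWU; have := hallF (U :|: W) (subsetT _).
by rewrite card_sv_imageU critU card_setU_subC // leq_add2l.
Qed.

Lemma critical_setU U W :
  #|sv_image F U| = #|U| -> critical_set (~: U) (sv_residual F U) W ->
  #|sv_image F (U :|: W)| = #|U :|: W|.
Proof.
by move=> critU [sWU _ critW]; rewrite card_sv_imageU critU critW card_setU_subC.
Qed.

Lemma hall_condition_neq0 D G x : hall_condition D G -> x \in D -> G x != set0.
Proof.
move=> hallG Dx; have := hallG [set x].
by rewrite sub1set sv_image1 cards1 card_gt0; apply.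
Qed.

Lemma critical_setP D G W :
  reflect (critical_set D G W)
    [&& W \subset D, W != set0 & #|sv_image G W| == #|W|].
Proof. by apply: (iffP and3P) => -[sWD W0 /eqP]. Qed.

(** An inclusion-minimal critical set works if a critical set exists; otherwise [D] itself is
    vacuously non-reducible. The block can thus fail to be critical only when it exhausts [D], as is
    allowed for the last block. *)
Lemma non_reducible_subset_exists D G :
  D != set0 ->
  exists2 W, non_reducible_set D G W & W != D -> critical_set D G W.
Proof.
move=> D0.
pose critical W := [&& W \subset D, W != set0 & #|sv_image G W| == #|W|].
have [[W critW]|noW] := altP (@existsP _ critical); last first.
  exists D; last by rewrite eqxx.
  by split=> // W' _ /critical_setP critW'; case/existsP: noW; exists W'.
have [V /minsetP[/critical_setP critV minV] _] := minset_exists critW.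
exists V => //; case: (critV) => sVD V0 _; split=> // W' /properP[sW'V [x Vx nW'x]].
by move=> /critical_setP critW'; rewrite (minV _ critW' sW'V) Vx in nW'x.
Qed.

(** Stating this for an arbitrary already covered [U] permits induction on the size of [~: U]. The
    default [set0] of [nth] is never reached, as all indices stay below [size s]. *)
Lemma hall_blocks_exist U :
  hall_condition [set: X] F -> #|sv_image F U| = #|U| -> ~: U != set0 ->
  exists s : seq {set X},
    [/\ 0 < size s, U :|: \bigcup_(j < size s) nth set0 s j = [set: X]
      & forall i, i < size s ->
        let V := U :|: \bigcup_(j < i) nth set0 s j in
        let G := sv_residual F V in
        [/\ forall x, x \in nth set0 s i -> G x != set0,
            non_reducible_set (~: V) G (nth set0 s i)
          & i.+1 < size s -> critical_set (~: V) G (nth set0 s i)]].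
Proof.
move=> hallF; have [n] := ubnP #|~: U|; elim: n U => // n IHn U ltUn critU U'0.
have [W nredW critW] := non_reducible_subset_exists (sv_residual F U) U'0.
have [sWU W0 _] := nredW.
have G0 x : x \in W -> sv_residual F U x != set0.
  move=> Wx; apply: (hall_condition_neq0 (hall_condition_residual hallF critU)).
  exact: (subsetP sWU).
(* If [W] fills [~: U], it is the only block, and the criticality clause is vacuous. *)
have [eqWU|neqWU] := eqVneq W (~: U).
  exists [:: W]; split=> //=; first by rewrite big_ord1 eqWU setUCr.
  by case=> // _; rewrite big_ord0 setU0; split.
have {}critW := critW neqWU.
have ltUW : #|~: (U :|: W)| < n.
  rewrite (leq_trans _ (_ : #|~: U| <= n)) // setCU -setDE cardsD (setIidPr sWU).
  by rewrite ltn_subrL !card_gt0 W0.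
have UW'0 : ~: (U :|: W) != set0.
  apply: contra neqWU => /eqP UW'0; rewrite eqEsubset sWU /=.
  by rewrite -setD_eq0 setDE -setCU UW'0.
have [s [s0 covs blocks]] := IHn _ ltUW (critical_setU critU critW) UW'0.
exists (W :: s); split=> //=; first by rewrite big_ord_recl setUA.
case=> [|i] lti /=; first by rewrite big_ord0 setU0; split.
(* The blocks before index [i.+1] of [W :: s] are [W] and the first [i] of [s]; moving [W] into [U]
   gives the induction hypothesis. *)
by rewrite big_ord_recl setUA; exact: blocks.
Qed.

End HallPartitionExistence.

Theorem theorem3p1 (X Y : finType) (hX : 0 < #|X|) (hY : 0 < #|Y|)
  (F : X -> {set Y}) (hF : hall_condition [set: X] F) :
  exists (m : nat) (W : m.-tuple {set X}), hall_partition F W.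
Proof.
have crit0 : #|sv_image F set0| = #|@set0 X| by rewrite sv_image0 !cards0.
have T0 : ~: @set0 X != set0 by rewrite setC0 -card_gt0 cardsT.
have [s [s0 covs blocks]] := hall_blocks_exist hF crit0 T0.
rewrite set0U in covs.
exists (size s), (in_tuple s).
have tnthE i : tnth (in_tuple s) i = nth set0 s i by rewrite (tnth_nth set0).
(* The term [set0 :|:] matches the blocks obtained from the starting set [U = set0]. *)
have earlierE i :
    earlier_blocks (in_tuple s) i = set0 :|: \bigcup_(j < i) nth set0 s j.
  rewrite set0U (big_ord_widen _ (nth set0 s) (ltnW (ltn_ord i))).
  by apply: eq_bigr => j _.
have disj (i j : 'I_(size s)) : i < j -> [disjoint nth set0 s i & nth set0 s j].
  (* Block [j] lies in the complement of all earlier blocks, block [i] among them. *)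
  move=> ltij; have [_ [sjC _ _] _] := blocks j (ltn_ord j).
  rewrite disjoint_sym disjoints_subset (subset_trans sjC) // setCS set0U.
  exact: (bigcup_sup (Ordinal ltij)).
split=> //.
- split.
  + by move=> i; rewrite tnthE; have [_ [_ ? _] _] := blocks i (ltn_ord i).
  + move=> i j; rewrite !tnthE -val_eqE neq_ltn => /orP[] /disj //.
    by rewrite disjoint_sym.
  + by rewrite -covs; apply: eq_bigr => i _.
- by move=> i x; rewrite tnthE earlierE; have [+ _ _] := blocks i (ltn_ord i); apply.
- by move=> i; rewrite tnthE earlierE; have [] := blocks i (ltn_ord i).
- by move=> i; rewrite tnthE earlierE; have [] := blocks i (ltn_ord i).
Qed.
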